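(* Let $L$ be a geometric lattice of finite rank greater than $1$ (of arbitrary, possibly infinite, cardinality). Then $L$ has a matching, i.e., there is an injective function $f:\mathcal A(L)\to\mathcal H(L)$ such that $p\le f(p)$ for every $p\in\mathcal A(L)$.
   Context: For elements $x\le y$ of a poset, $x\lessdot y$ ($y$ covers $x$, $x$ is a lower cover of $y$) means that the closed interval $[x,y]=\{z: x\le z\le y\}$ has exactly two elements. A poset $P$ is semimodular if for all $a,b,c\in P$, $a\lessdot b$, $a\lessdot c$ and $b\ne c$ imply that there exists $d\in P$ with $b\lessdot d$ and $c\lessdot d$. In a poset with least element $0$, an atom (point) is an element covering $0$; in a poset with greatest element $1$, a hyperplane (co-atom) is a lower cover of $1$. The set of atoms of $L$ is denoted $\mathcal A(L)$ and the set of hyperplanes $\mathcal H(L)$. A geometric lattice of finite height (equivalently, of finite rank) is a semimodular lattice $L$ with no infinite chains (totally ordered subsets), so that $L$ has a least element $0$ and a greatest element $1$, such that every element of $L$ is a join of a subset of atoms (the empty join being $0$). In such a lattice all maximal chains have the same finite size $r+1$, and $r$ is called the rank (or height) of $L$. A matching of a geometric lattice $L$ of finite rank at least $2$ is an injective function $f:\mathcal A(L)\to\mathcal H(L)$ with $p\le f(p)$ for all $p\in\mathcal A(L)$ (in rank $2$, $\mathcal A(L)=\mathcal H(L)$, so the identity is a matching). *)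

(* Defs.v *)
From mathcomp Require Export all_boot all_order.
From mathcomp Require Export mathcomp_extra boolp classical_sets functions.
From mathcomp Require Export cardinality.

Set Implicit Arguments.
Unset Strict Implicit.
Unset Printing Implicit Defensive.

Local Open Scope classical_set_scope.
Local Open Scope card_scope.
Local Open Scope order_scope.

Section Poset.
Context (d : Order.disp_t) (P : porderType d).
Implicit Types (x y a b c : P) (C D : set P).

(* [x <= y] is implied: the interval is empty otherwise. *)
Definition covers x y : Prop := [set z | x <= z <= y] #= `I_2.

Definition semimodular : Prop :=
  forall a b c, covers a b -> covers a c -> b <> c ->
    exists e, covers b e /\ covers c e.

Definition chain C : Prop := total_on C <=%O.

Definition maximal_chain C : Prop :=
  chain C /\ forall D, C `<` D -> ~ chain D.

Definition no_infinite_chains : Prop := forall C, chain C -> finite_set C.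

End Poset.

Section Lattice.
Context (d : Order.disp_t) (L : tbLatticeType d).

Definition atoms : set L := [set p | covers \bot p].

Definition hyperplanes : set L := [set h | covers h \top].

(* [supremums S] is the set of least upper bounds of [S]; for [S = set0] it is
   [[set \bot]]. *)
Definition atomistic : Prop :=
  forall x : L, exists2 S : set L, S `<=` atoms & supremums S x.

Definition geometric : Prop :=
  [/\ semimodular L, no_infinite_chains L & atomistic].

(* Maximal chains always exist (Zorn), so at most one [r] satisfies this. *)
Definition has_rank (r : nat) : Prop :=
  forall C : set L, maximal_chain C -> C #= `I_r.+1.

(* A set coerces to the type of its elements, and [val] is the inclusion. *)
Definition is_matching (f : atoms -> hyperplanes) : Prop :=
  injective f /\ forall p : atoms, val p <= val (f p).

End Lattice.

Arguments atoms {d} L _.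
Arguments hyperplanes {d} L _.

(* Main.v *)
From mathcomp Require Import finmap.
Require Import Defs.
From mathcomp Require Import all_algebra zify.
From mathcomp Require wochoice.
From Stdlib Require Import Wellfounded.

(** Call the atoms points and the joins of two points lines.  A matching is
    built in every interval [[u, \top]] of length at least two, by induction
    downwards on [u]; in length two every point is a hyperplane.  In greater
    length, the intervals above the points are matchable by induction.

    The key consequence ([nonincident_projection]): if a point [p] is not on a
    hyperplane [h], then the points [a] of [h] have distinct hyperplanes
    containing [p] and [a].  In particular [p] lies on at least as many
    hyperplanes as [h] has points.

    Finitely many points ([finite_atoms_matchable]).  Hall's condition is
    checked for a set [S] of points.  If [S] lies in a hyperplane, the
    projection from a point off it provides the distinct hyperplanes.
    Otherwise the inequality above, together with the weighted double count
    which proves the de Bruijn-Erdos theorem, shows that [S] meets at least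
    [#|S|] hyperplanes.

    Infinitely many points, say [kappa] of them.  If two points [p] and [q] lie
    on fewer than [kappa] hyperplanes each, then, since a point off the line
    through [p] and [q] is determined by the lines joining it to [p] and [q],
    and since a product of two cardinals below [kappa] is below [kappa], there
    are fewer than [kappa] points off that line.  So either there is such a
    dominant line, and a matching is found by hand
    ([dominant_line_matchable]), or all points but at most one lie on at least
    [kappa] hyperplanes, and a transfinite greedy choice finds a matching
    ([spread_matchable]).  The greedy choice also proves the two facts on
    cardinals that are needed, comparability and Hessenberg's theorem. *)

Set Implicit Arguments.
Unset Strict Implicit.
Unset Printing Implicit Defensive.

(** * Well-orderings, greedy choice and infinite cardinals *)

Section Cardinals.
Local Open Scope classical_set_scope.
Local Open Scope card_scope.

Lemma injective_card_le T U (A : set T) (B : set U) (f : T -> U) :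
    (forall x, A x -> B (f x)) ->
    (forall x y, A x -> A y -> f x = f y -> x = y) ->
  A #<= B.
Proof.
move=> fB fI; have fI' : {in A &, injective f}.
  by move=> x y /set_mem Ax /set_mem Ay; exact: fI.
rewrite -(card_le_eql (inj_card_eq fI')); apply: subset_card_le.
by move=> _ [x Ax <-]; exact: fB.
Qed.

Lemma card_le_injective T U (A : set T) (B : set U) (u : U) : A #<= B ->
  exists f : T -> U, (forall x, A x -> B (f x)) /\
    (forall x y, A x -> A y -> f x = f y -> x = y).
Proof.
move=> /card_leP[g]; have [f fAB fI] : exists2 f : T -> U, set_fun A B f & set_inj A f.
  by apply/injfunPex; squash (valLR u g).
by exists f; split=> // x y /mem_set Ax /mem_set Ay; exact: fI.
Qed.

Lemma card_le_setX T T' U U' (A : set T) (A' : set T') (B : set U) (B' : set U') :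
  A #<= A' -> B #<= B' -> A `*` B #<= A' `*` B'.
Proof.
have [->|/set0P[[a b] [/= Aa Bb]]] := eqVneq (A `*` B) set0; first by rewrite card_ge0.
move=> leA leB; have /set0P[a' _] : A' != set0.
  by apply: contraTneq leA => ->; rewrite card_le0; apply/set0P; exists a.
have /set0P[b' _] : B' != set0.
  by apply: contraTneq leB => ->; rewrite card_le0; apply/set0P; exists b.
have [f [fA fI]] := card_le_injective a' leA.
have [g [gB gI]] := card_le_injective b' leB.
apply: (injective_card_le (f := fun x => (f x.1, g x.2))) => [[x y] [/= Ax By]|].
  by split; [exact: fA|exact: gB].
by move=> [x y] [z t] /= [Ax By] [Az Bt] [/fI -> // /gI ->].
Qed.

Section WellOrdering.
Variables (T : Type).
Implicit Types (D : set T) (lt : T -> T -> Prop).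

(** The strict relation is well founded everywhere but total only on [D]:
    orders pulled back along a map that is injective on [D] are then of this
    kind. *)
Definition well_ordering D lt := well_founded lt /\
  forall s t, D s -> D t -> [\/ lt s t, s = t | lt t s].

Definition below D lt t : set T := [set s | D s /\ lt s t].

End WellOrdering.

Lemma well_founded_min T (lt : T -> T -> Prop) (P : set T) :
  well_founded lt -> P !=set0 -> exists2 x, P x & forall y, lt y x -> ~ P y.
Proof.
move=> wf [x Px]; apply: contrapT => nomin.
elim: (wf x) Px => {}x _ IH Px; apply: nomin; exists x => // y ylt Py; exact: IH Py.
Qed.

Lemma well_ordering_exists (T : eqType) :
  exists2 lt, well_ordering [set: T] lt & forall x y z, lt x y -> lt y z -> lt x z.
Proof.
have [R woR] := wochoice.well_ordering_principle T.
pose lt x y := ~~ R y x.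
have minR (P : set T) : P !=set0 -> exists2 z, P z & forall x, P x -> R z x.
  move=> [x Px]; have [|z [[/asboolP Pz zmin] _]] := woR [pred x | `[< P x >]].
    by exists x; apply/asboolP.
  by exists z => // y Py; apply: zmin; apply/asboolP.
have wf : well_founded lt.
  move=> x; apply: contrapT => nAx.
  have [|z /= nAz zmin] := minR [set x | ~ Acc lt x]; first by exists x.
  by apply: nAz; constructor=> y; apply: contraPP => /zmin; rewrite /lt => ->.
have tri x y : [\/ lt x y, x = y | lt y x].
  have [xy|/negP nxy] := boolP (R y x); last by constructor 1; exact/negP.
  have [yx|/negP nyx] := boolP (R x y); last by constructor 3; exact/negP.
  constructor 2; have [|z [_ zu]] := woR (pred2 x y).
    by exists x; rewrite inE eqxx.
  have minx (a b : T) : R a b -> R a a -> wochoice.minimum_of R (pred2 a b) a.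
    by move=> ab aa; split=> [|c]; rewrite !inE ?eqxx// => /orP[]/eqP->.
  have rr a : R a a by have [|z' -> /(_ a)] := minR [set a]; [exists a|exact].
  rewrite -(zu x (minx _ _ yx (rr x))) -(zu y)//.
  split=> [|c]; rewrite !inE ?eqxx ?orbT// => /orP[]/eqP->//; exact: rr.
exists lt; first by split.
have irr x : ~ lt x x by elim: (wf x) => {}x _ IH xx; exact: (IH x xx xx).
move=> x y z xy yz; case: (tri x z) => // [xz|zx].
  subst z; have [|m [->|->] h] := well_founded_min (P := [set x; y]) wf.
  - by exists x; left.
  - by case: (h _ yz); right.
  - by case: (h _ xy); left.
(* A cycle of length three has no minimal element. *)
have [|m] := well_founded_min (P := [set a | [\/ a = x, a = y | a = z]]) wf.
  by exists x; constructor.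
by case=> -> h; [case: (h _ zx)|case: (h _ xy)|case: (h _ yz)]; constructor.
Qed.

(** Transfinite greedy choice: when the value at [t] is chosen, at most as many
    values are taken as there are elements below [t], so one element of [F t]
    is still free. *)
Lemma greedy_injection T (U : choiceType) (u : U) (D : set T) lt (F : T -> set U) :
    well_ordering D lt -> (forall t, D t -> ~ (F t #<= below D lt t)) ->
  exists f : T -> U, (forall t, D t -> F t (f t)) /\
    (forall s t, D s -> D t -> f s = f t -> s = t).
Proof.
move=> [wf tri] big.
pose step t (g : forall s, lt s t -> U) : U :=
  xget u [set x | F t x /\ forall s (st : lt s t), D s -> g s st <> x].
pose f := Fix wf (fun _ => U) step.
have fE t : f t = xget u [set x | F t x /\ forall s, lt s t -> D s -> f s <> x].
  rewrite /f Fix_eq// => {}t g h gh; congr (xget u _).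
  apply/seteqP; split=> x /= [Fx xg]; split=> // s st; move: (xg s st);
    by rewrite gh.
have fP t : D t -> F t (f t) /\ forall s, lt s t -> D s -> f s <> f t.
  move=> Dt; have := xgetPex u
    (P := [set x | F t x /\ forall s, lt s t -> D s -> f s <> x]).
  rewrite -fE; apply; apply: contrapT => none.
  apply: (big _ Dt); apply: card_le_trans (card_image_le f (below D lt t)).
  apply: subset_card_le => x Fx; apply: contrapT => nx; apply: none.
  by exists x; split=> // s st Ds fs; apply: nx; exists s.
exists f; split=> [t /fP[]//|s t Ds Dt fst].
by case: (tri s t Ds Dt) => // st;
  [case: ((fP t Dt).2 s st Ds)|case: ((fP s Ds).2 t st Dt)].
Qed.

(** Every set has a well-ordering of the least order type for its
    cardinality.  If some initial segment is as large as [D], take the first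
    such segment, say below [x], and pull the order back along an injection of
    [D] into it; the new segments inject into segments of elements before
    [x]. *)
Lemma initial_well_ordering (T : eqType) (D : set T) :
  exists2 lt, well_ordering D lt & forall t, D t -> ~ (D #<= below D lt t).
Proof.
have [lt [wf tri] _] := well_ordering_exists T.
have [[x [Dx Dlex]]|none] := pselect (exists x, D x /\ D #<= below D lt x); last first.
  by exists lt => [|t Dt le]; [split=> // s t _ _; exact: tri|apply: none; exists t].
have [|{Dx Dlex}x [Dx /(card_le_injective x)[i [iD iI]]] xmin] :=
    well_founded_min (P := [set x | D x /\ D #<= below D lt x]) wf.
  by exists x.
exists (fun s t => lt (i s) (i t)).
  split; first exact: wf_inverse_image.
  move=> s t Ds Dt; case: (tri (i s) (i t)) => //;
    [constructor 1|move=> /iI|constructor 3] => //.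
  by move=> -> //; constructor 2.
move=> t Dt le; have [Dit itx] := iD _ Dt.
apply: (xmin _ itx); split=> //; apply: card_le_trans le _.
apply: (injective_card_le (f := i)) => [s [Ds st]|s r [Ds _] [Dr _]]; last exact: iI.
by split=> //; have [] := iD _ Ds.
Qed.

(** A family of sets, each at least as large as the index set, has an injective
    choice function: along a well-ordering of least order type the greedy
    choice never gets stuck. *)
Lemma injective_choice (T : eqType) (U : choiceType) (u : U) (D : set T)
    (F : T -> set U) :
    (forall t, D t -> D #<= F t) ->
  exists f : T -> U, (forall t, D t -> F t (f t)) /\
    (forall s t, D s -> D t -> f s = f t -> s = t).
Proof.
move=> DF; have [lt wo ini] := initial_well_ordering D.
apply: (greedy_injection u wo) => t Dt le; apply: (ini _ Dt).
exact: card_le_trans (DF _ Dt) le.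
Qed.

(** The greedy choice of values in [B] along a well-ordering of [A] either runs
    to the end, or stops at an initial segment at least as large as [B]. *)
Lemma card_le_total (T : eqType) (U : choiceType) (A : set T) (B : set U) :
  A #<= B \/ B #<= A.
Proof.
have [->|/set0P[u _]] := eqVneq B set0; first by right; rewrite card_ge0.
have [lt wo _] := initial_well_ordering A.
have [big|] := pselect (forall t, A t -> ~ (B #<= below A lt t)).
  have [f [fB fI]] := greedy_injection (F := fun=> B) u wo big.
  by left; exact: injective_card_le fB fI.
move=> /existsNP[t /not_implyP[At /contrapT le]]; right.
by apply: card_le_trans le _; apply: subset_card_le => s [].
Qed.

(** Hilbert's hotel: [x] moves into the first place of a sequence of distinct
    elements of [D], and every element of the sequence moves up by one. *)
Lemma infinite_setU1_card_le T (D : set T) (x : T) :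
  infinite_set D -> x |` D #<= D.
Proof.
move=> /infiniteP/(card_le_injective x)[g [gD gI]].
have {}gD n : D (g n) by exact: gD.
have {}gI m n : g m = g n -> m = n by exact: gI.
have [Dx|nDx] := pselect (D x).
  by apply: subset_card_le => y [->|].
pose f y := if pselect (y = x) is left _ then g 0%N else
  if pselect (exists n, y = g n) is left h then g (projT1 (cid h)).+1 else y.
have fx : f x = g 0%N by rewrite /f; case: pselect.
have fg n : f (g n) = g n.+1.
  rewrite /f; case: pselect => [gx|_]; first by case: nDx; rewrite -gx.
  case: pselect => [h|]; last by case; exists n.
  by case: cid => m e /=; rewrite (gI _ _ e).
have fy y : D y -> (forall n, y <> g n) -> f y = y.
  move=> Dy ny; rewrite /f; case: pselect => [yx|_]; first by case: nDx; rewrite -yx.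
  by case: pselect => // h; case: h => n yg; case: (ny n).
have caseD y : (x |` D) y -> [\/ y = x, exists n, y = g n | D y /\ forall n, y <> g n].
  case=> [->|Dy]; first by constructor 1.
  have [h|h] := pselect (exists n, y = g n); first by constructor 2.
  constructor 3; split=> // n yg.
  by apply: h; exists n.
apply: (injective_card_le (f := f)) => [y /caseD[->|[n ->]|[Dy ny]]|].
- by rewrite fx.
- by rewrite fg.
- by rewrite fy.
move=> y z /caseD[->|[n ->]|[Dy ny]] /caseD[->|[m ->]|[Dz nz]];
  rewrite ?fx ?fg ?[f y]fy ?[f z]fy//.
- by move=> /gI.
- by move=> /esym/nz.
- by move=> /gI.
- by move=> /gI[->].
- by move=> /esym/nz.
- by move=> /ny.
- by move=> /ny.
Qed.

Lemma infinite_setD1_card_ge T (D : set T) (x : T) :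
  infinite_set D -> D #<= D `\ x.
Proof.
move=> Dinf; have [Dx|nDx] := pselect (D x).
  have D'inf : infinite_set (D `\ x).
    apply: contra_not Dinf => D'fin.
    by rewrite -(setD1K Dx) finite_setU; split; [exact: finite_set1|].
  by have := infinite_setU1_card_le x D'inf; rewrite setD1K.
by apply: subset_card_le => y Dy; split=> // yx; apply: nDx; rewrite -yx.
Qed.

Definition larger T (lt : T -> T -> Prop) (p : T * T) : T :=
  if pselect (lt p.1 p.2) is left _ then p.2 else p.1.

(** The canonical order of pairs used for the square of a cardinal: by the
    larger coordinate first, and by an arbitrary well-ordering [ltX] among pairs
    with the same one.  The pairs below [p] then lie in the square of an
    initial segment. *)
Definition by_larger T (lt : T -> T -> Prop) (ltX : T * T -> T * T -> Prop) p q :=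
  lt (larger lt p) (larger lt q) \/ larger lt p = larger lt q /\ ltX p q.

Lemma by_larger_well_ordering T (lt : T -> T -> Prop) ltX :
  well_ordering [set: T] lt -> well_ordering [set: T * T] ltX ->
  well_ordering [set: T * T] (by_larger lt ltX).
Proof.
move=> [wf tri] [wfX triX]; split=> [p|p q _ _]; last first.
  rewrite /by_larger; case: (tri (larger lt p) (larger lt q)) => // [?|mpq|?].
  - by constructor 1; left.
  - case: (triX p q) => // ?.
    + by constructor 1; right.
    + by constructor 2.
    + by constructor 3; right.
  - by constructor 3; left.
have [n mp] : exists n, larger lt p = n by exists (larger lt p).
elim: (wf n) p mp => {}n _ IHn p.
elim: (wfX p) => {}p _ IHp mp; constructor=> q [|[mq qp]].
  by rewrite mp => ltq; apply: (IHn _ ltq).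
by apply: IHp => //; rewrite mq.
Qed.

Lemma below_by_larger T (D : set T) lt ltX (p : T * T) :
    well_ordering [set: T] lt -> (forall x y z, lt x y -> lt y z -> lt x z) ->
  below (D `*` D) (by_larger lt ltX) p `<=`
    (larger lt p |` below D lt (larger lt p)) `*` (larger lt p |` below D lt (larger lt p)).
Proof.
move=> [wf tri] tr [a b] [[/= Da Db] ltp].
suff le x : D x -> x = larger lt (a, b) \/ lt x (larger lt (a, b)) ->
    (larger lt p |` below D lt (larger lt p)) x.
  split; apply: le => //; rewrite /larger /=;
    case: pselect => [ab|nab]; do ?by [left|right].
  by case: (tri a b) => // [->|]; [left|right].
case: ltp => [ltp|[-> _]] Dx []; last by right.
- by move=> xm; right; split=> //; rewrite xm.
- by move=> xm; right; split=> //; exact: tr xm ltp.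
- by move=> ->; left.
Qed.

(** If [D] is larger than each of its initial segments, then [by_larger] is an
    order of the square of [D] whose initial segments embed in squares of
    smaller sets, hence are smaller than [D], and the greedy choice embeds the
    square in [D].  Otherwise [D] is as large as one of the segments, for which
    the claim is assumed. *)
Lemma infinite_square_step (T : choiceType) (D : set T) lt :
    well_ordering [set: T] lt -> (forall x y z, lt x y -> lt y z -> lt x z) ->
    (forall t, D t -> infinite_set (below D lt t) ->
       below D lt t `*` below D lt t #<= below D lt t) ->
  infinite_set D -> D `*` D #<= D.
Proof.
move=> wo tr sq Dinf; have [d Dd] := infinite_setN0 Dinf.
have belowD t : below D lt t #<= D by apply: subset_card_le => s [].
have [[x [Dx le]]|small] := pselect (exists x, D x /\ D #<= below D lt x).
  apply: card_le_trans (card_le_setX le le) _; apply: card_le_trans (belowD x).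
  by apply: sq => // /(card_le_finite le).
have [ltX woX _] := well_ordering_exists (T * T)%type.
have [||f [fD fI]] := greedy_injection (lt := by_larger lt ltX) (D := D `*` D)
    (F := fun=> D) d; last exact: injective_card_le fD fI.
  have [wf tri] := by_larger_well_ordering wo woX.
  by split=> // s t _ _; exact: tri.
move=> p [Dp1 Dp2] le; set m := larger lt p.
have Dm : D m by rewrite /m /larger; case: pselect.
have {}le : D #<= (m |` below D lt m) `*` (m |` below D lt m).
  by apply: card_le_trans le _; apply: subset_card_le; exact: below_by_larger.
have [fin|inf] := pselect (finite_set (below D lt m)).
  apply: Dinf; apply: card_le_finite le _.
  by apply: finite_setX; rewrite finite_setU; split.
apply: small; exists m; split=> //; apply: card_le_trans le _.
apply: card_le_trans (sq m Dm inf).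
by apply: card_le_setX; exact: infinite_setU1_card_le.
Qed.

(** Hessenberg's theorem, by well-founded induction on initial segments. *)
Lemma infinite_square_card_le (T : choiceType) (D : set T) :
  infinite_set D -> D `*` D #<= D.
Proof.
have [lt wo tr] := well_ordering_exists T.
apply: (infinite_square_step wo tr) => t _.
elim: (wo.1 t) => {}t _ IH; apply: (infinite_square_step wo tr) => s [Ds st].
suff -> : below (below D lt t) lt s = below D lt s by exact: IH.
apply/seteqP; split=> r /=; first by move=> [[]].
by move=> [Dr rs]; do 2![split=> //]; exact: tr rs st.
Qed.

(** The larger of the two factors absorbs the product. *)
Lemma infinite_card_le_setX (S : Type) (T U : choiceType) (D : set S)
    (A : set T) (B : set U) :
  infinite_set D -> D #<= A `*` B -> D #<= A \/ D #<= B.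
Proof.
move=> Dinf DAB.
have leC (V W : choiceType) (X : set V) (Y : set W) :
    X #<= Y -> D #<= X `*` Y -> D #<= Y.
  move=> XY DXY; have DYY := card_le_trans DXY (card_le_setX XY (card_lexx Y)).
  apply: (card_le_trans DYY (infinite_square_card_le _)).
  by move=> Yfin; apply: Dinf; apply: (card_le_finite DYY); exact: finite_setX.
have [AB|BA] := card_le_total A B; first by right; exact: leC DAB.
left; apply: leC BA _; apply: card_le_trans DAB _.
apply: (injective_card_le (f := fun p => (p.2, p.1))) => [[a b] []|] //.
by move=> [a b] [c e] _ _ [-> ->].
Qed.

End Cardinals.

(** * Hall's marriage theorem *)

Section Hall.
Variables T U : finType.
Implicit Types (N : T -> {set U}) (S : {set T}).

Definition Hall_condition N :=
  forall S, #|S| <= #|\bigcup_(t in S) N t|.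

Definition delete_edge t h N s := if s == t then N s :\ h else N s.

(** A set violating the condition after the deletion of the edge from [t] to
    [h] contains [t]; [A] is that set without [t]. *)
Lemma Hall_violation_mem N t h :
    Hall_condition N -> ~ Hall_condition (delete_edge t h N) ->
  exists2 A : {set T}, t \notin A &
    #|(N t :\ h) :|: \bigcup_(s in A) N s| <= #|A|.
Proof.
move=> HN /existsNP[S /negP]; rewrite -ltnNge.
have [tS|tS] := boolP (t \in S).
  rewrite (big_setD1 t)//= (cardsD1 t S) tS /delete_edge eqxx add1n ltnS.
  rewrite (eq_bigr N) => [le|s]; last by rewrite !inE => /andP[/negPf->].
  by exists (S :\ t); rewrite // !inE eqxx.
rewrite (eq_bigr N) => [|s sS]; first by rewrite ltnNge HN.
by rewrite /delete_edge; case: eqP => // st; rewrite -st sS in tS.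
Qed.

(** Rado's submodularity step.  Let [t |: A] and [t |: B] violate the condition
    after deleting one edge at [t] or the other.  The union of their
    neighbourhoods [X] and [Y] contains all neighbours of [t |: (A :|: B)],
    because only one edge is missing in each, and the intersection contains
    those of [A :&: B].  Adding the two instances of the condition gives
    [#|A| + #|B| + 1 <= #|X| + #|Y|], whereas [#|X| <= #|A|] and
    [#|Y| <= #|B|]. *)
Lemma Hall_delete_edge N t h1 h2 : Hall_condition N -> h1 != h2 ->
  Hall_condition (delete_edge t h1 N) \/ Hall_condition (delete_edge t h2 N).
Proof.
move=> HN h12; apply: contrapT => /not_orP[].
move=> /(Hall_violation_mem HN)[A tA leA] /(Hall_violation_mem HN)[B tB leB].
set X := _ :|: _ in leA; set Y := _ :|: _ in leB.
have le_cup : (#|A :|: B|).+1 <= #|X :|: Y|.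
  have -> : (#|A :|: B|).+1 = #|t |: (A :|: B)| by rewrite cardsU1 !inE negb_or tA tB.
  apply: leq_trans (HN _) (subset_leq_card _); apply/bigcupsP => s.
  rewrite !inE => /or3P[/eqP->|sA|sB].
  - apply/fintype.subsetP=> h ht; rewrite !inE ht !andbT.
    by case: (eqVneq h h1) => [->|]; rewrite ?h12 ?orbT.
  - apply: fintype.subset_trans (finset.bigcup_sup _ sA) _.
    by apply/fintype.subsetP => h hh; rewrite !inE hh !orbT.
  - apply: fintype.subset_trans (finset.bigcup_sup _ sB) _.
    by apply/fintype.subsetP => h hh; rewrite !inE hh !orbT.
have le_cap : #|A :&: B| <= #|X :&: Y|.
  apply: leq_trans (HN _) (subset_leq_card _); apply/bigcupsP => s /setIP[sA sB].
  apply/fintype.subsetP=> h hs; rewrite !inE; apply/andP.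
  by split; apply/orP; right; apply/bigcupP; exists s.
have := leq_add le_cup le_cap; rewrite cardsUI addSn cardsUI => lt.
by have := leq_trans lt (leq_add leA leB); rewrite ltnn.
Qed.

(** Edges are deleted while some vertex has two neighbours; in the end every
    vertex has exactly one, and the condition for pairs makes that choice
    injective. *)
Theorem Hall_marriage N : Hall_condition N ->
  exists2 f : T -> U, injective f & forall t, f t \in N t.
Proof.
have [n] := ubnP (\sum_t #|N t|); elim: n => // n IHn in N *; rewrite ltnS => leN HN.
have [[t [h1 [h2 [h1t h2t h12]]]]|thin] := pselect (exists t h1 h2,
    [/\ h1 \in N t, h2 \in N t & h1 != h2]).
  have small h : h \in N t -> \sum_s #|delete_edge t h N s| < n.
    move=> ht; apply: leq_trans leN; rewrite (bigD1 t)//= [ltnRHS](bigD1 t)//=.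
    rewrite /delete_edge eqxx (cardsD1 h (N t)) ht add1n addSn ltnS leq_add2l.
    by apply: leq_sum => s /negPf->.
  have sub h s : delete_edge t h N s \subset N s.
    by rewrite /delete_edge; case: eqP => // _; exact: subD1set.
  have [HN1|HN2] := Hall_delete_edge t HN h12.
    have [f fI fN] := IHn _ (small _ h1t) HN1.
    by exists f => // s; exact: (fintype.subsetP (sub h1 s)).
  have [f fI fN] := IHn _ (small _ h2t) HN2.
  by exists f => // s; exact: (fintype.subsetP (sub h2 s)).
have /choice[f fN] t : exists h, h \in N t.
  apply/finset.set0Pn; rewrite -card_gt0.
  by have := HN [set t]; rewrite cards1 big_set1.
exists f => // s t fst; apply/eqP; apply: contrapT => /negP st.
have := HN [set s; t]; rewrite cards2 st big_setU1 ?inE//= big_set1.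
suff -> : N s :|: N t = [set f s] by rewrite cards1.
apply/setP => h; rewrite !inE; apply/orP/eqP => [|->]; last by left.
move=> hst; apply/eqP; apply: contrapT => /negP hf; apply: thin.
by case: hst => hN; [exists s|exists t]; exists h, (f s); split=> //; rewrite fst.
Qed.

End Hall.

(** * Finite incidence structures *)

Section Nonincident.
Import Order.TTheory GRing.Theory Num.Theory.
Variables T U : finType.
Variable e : T -> U -> bool.

(** Motzkin's and Conway's weighted count behind the de Bruijn-Erdos theorem.
    Give the nonincident pair [(p, h)] the weight [w1 p] or [w2 h], chosen so
    that either weighting has total [1].  If [#|B| < #|S|], then
    [k h <= r p] makes [w2 h < w1 p] on every such pair, which is absurd.  Here
    [r p] and [k h] are the degrees, introduced through the numbers of
    nonincidences so that the hypotheses are additive. *)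
Lemma nonincident_card_le (S : {set T}) (B : {set U}) (r : T -> nat) (k : U -> nat) :
    S != finset.set0 ->
    (forall p, p \in S -> #|[set h in B | ~~ e p h]| + r p = #|B|) ->
    (forall h, h \in B -> #|[set p in S | ~~ e p h]| + k h = #|S|) ->
    (forall p, p \in S -> 0 < r p < #|B|) ->
    (forall h, h \in B -> k h < #|S|) ->
    (forall p h, p \in S -> h \in B -> ~~ e p h -> k h <= r p) ->
  #|S| <= #|B|.
Proof.
move=> /finset.set0Pn[p0 p0S] cardr cardk r_lt k_lt k_le_r.
rewrite leqNgt; apply/negP => ltBS.
have B_gt0 : 0 < #|B| by have /andP[_] := r_lt _ p0S; exact: leq_trans.
have S_gt0 : 0 < #|S| by apply: leq_trans ltBS.
pose w1 p : rat := ((#|S|%:R * #|[set h in B | ~~ e p h]|%:R)^-1)%R.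
pose w2 h : rat := ((#|B|%:R * #|[set p in S | ~~ e p h]|%:R)^-1)%R.
have w21 p h : p \in S -> h \in B -> ~~ e p h -> (w2 h < w1 p)%R.
  move=> pS hB ph.
  rewrite ltf_pV2 -?natrM ?ltr_nat ?posrE ?ltr0n ?muln_gt0 ?B_gt0 ?S_gt0 /=.
  - have := cardr _ pS; have := cardk _ hB; have := k_le_r _ _ pS hB ph.
    have /andP[] := r_lt _ pS; nia.
  - by have := cardk _ hB; have := k_lt _ hB; lia.
  - by have := cardr _ pS; have /andP[] := r_lt _ pS; lia.
have sum1 : (\sum_(p in S) \sum_(h in B | ~~ e p h) w1 p = 1)%R.
  rewrite (eq_bigr (fun=> #|S|%:R^-1)%R) => [|p pS].
    by rewrite sumr_const -[LHS]mulr_natl mulfV// pnatr_eq0 -lt0n.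
  rewrite sumr_const (_ : #|_| = #|[set h in B | ~~ e p h]|); last first.
    by apply: eq_card => h; rewrite !inE.
  rewrite -[LHS]mulr_natl /w1 invfM mulrCA mulfV ?mulr1//.
  by rewrite pnatr_eq0; have := cardr _ pS; have /andP[] := r_lt _ pS; lia.
have sum2 : (\sum_(h in B) \sum_(p in S | ~~ e p h) w2 h = 1)%R.
  rewrite (eq_bigr (fun=> #|B|%:R^-1)%R) => [|h hB].
    by rewrite sumr_const -[LHS]mulr_natl mulfV// pnatr_eq0 -lt0n.
  rewrite sumr_const (_ : #|_| = #|[set p in S | ~~ e p h]|); last first.
    by apply: eq_card => p; rewrite !inE.
  rewrite -[LHS]mulr_natl /w2 invfM mulrCA mulfV ?mulr1//.
  by rewrite pnatr_eq0; have := cardk _ hB; have := k_lt _ hB; lia.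
have : (\sum_(p in S) \sum_(h in B | ~~ e p h) w2 h <
        \sum_(p in S) \sum_(h in B | ~~ e p h) w1 p)%R.
  apply: ltr_sum => [|p pS].
    by apply/hasP; exists p0; rewrite ?mem_index_enum.
  apply: ltr_sum => [|h /andP[hB ph]]; last exact: w21.
  have : 0 < #|[set h in B | ~~ e p h]|.
    by have := cardr _ pS; have /andP[] := r_lt _ pS; lia.
  rewrite card_gt0 => /finset.set0Pn[h]; rewrite inE => hh.
  by apply/hasP; exists h; rewrite ?mem_index_enum.
rewrite sum1 (exchange_big_dep (mem B))/=; last by move=> p h _ /andP[].
suff -> : (\sum_(j in B) \sum_(i in S | (j \in B) && ~~ e i j) w2 j = 1)%R.
  by rewrite ltxx.
by rewrite -sum2; apply: eq_bigr => h hB; apply: eq_bigl => p; rewrite hB.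
Qed.

(** The last hypothesis, which projects the points on a block [h] from a point
    [p] off [h], has two uses.  It proves Hall's condition for a set [S] of
    points on a common block, and it bounds the number of points on [h] by the
    degree of [p], which is what the weighted count needs for all other [S]. *)
Lemma finite_nonincidence_matching :
    (forall p, exists h, e p h) ->
    (forall p q, p != q -> exists h, e p h && ~~ e q h) ->
    (forall h, exists p, ~~ e p h) ->
    (forall p h, ~~ e p h -> exists g : T -> U,
       (forall q, e q h -> e q (g q) && e p (g q)) /\
       {in [pred q | e q h] &, injective g}) ->
  exists2 f : T -> U, injective f & forall p, e p (f p).
Proof.
move=> cov sep non proj.
suff /Hall_marriage[f fI fe] : Hall_condition (fun p => [set h | e p h]).
  by exists f => // p; have := fe p; rewrite inE.
move=> S; set B := \bigcup_(t in S) _.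
have inB p h : p \in S -> e p h -> h \in B.
  by move=> pS ph; apply/bigcupP; exists p; rewrite ?inE.
have [->|S0] := eqVneq S finset.set0; first by rewrite cards0.
(* If a block [h] contains [S], project from a point off [h]. *)
have [[h Sh]|nSh] := pselect (exists h, forall p, p \in S -> e p h).
  have [p /proj[g [ge gI]]] := non h.
  rewrite -(card_in_imset (f := g) (D := mem S)).
    apply/subset_leq_card/fintype.subsetP => _ /imsetP[q qS ->].
    by apply: (inB q) => //; have /andP[] := ge _ (Sh _ qS).
  by move=> x y xS yS; apply: gI; rewrite inE; exact: Sh.
pose r p := #|[set h | e p h]|; pose k h := #|[set p in S | e p h]|.
rewrite leqNgt; apply/negP => ltBS.
have rB p : p \in S -> [set h | e p h] \subset B.
  by move=> pS; apply/fintype.subsetP => h; rewrite inE; exact: inB.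
suff : #|S| <= #|B| by rewrite leqNgt ltBS.
have splitC (V : finType) (D : {set V}) (P : pred V) :
    #|[set x in D | ~~ P x]| + #|[set x in D | P x]| = #|D|.
  rewrite addnC -cardsUI (_ : _ :&: _ = finset.set0) ?cards0 ?addn0; last first.
    by apply/setP => x; rewrite !inE; case: (P x); rewrite ?andbF.
  by apply: eq_card => x; rewrite !inE; case: (x \in D); case: (P x).
apply: (@nonincident_card_le S B r k) => //.
- move=> p pS; rewrite /r -[RHS](splitC _ B (e p)); congr (_ + _).
  apply: eq_card => h; rewrite !inE andbC; case ph: (e p h) => //=.
  by rewrite (inB p).
- move=> p pS; apply/andP; split.
    have [h ph] := cov p.
    by rewrite card_gt0; apply/finset.set0Pn; exists h; rewrite inE.
  rewrite ltn_neqAle subset_leq_card ?rB// andbT; apply/eqP => rpB.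
  have NpB : [set h | e p h] = B by apply/eqP; rewrite eqEcard rB//= -rpB.
  have [q qS qp] : exists2 q, q \in S & q != p.
    apply: contrapT => nq; have : S \subset [set p].
      apply/fintype.subsetP => q qS; rewrite inE; apply/negPn/negP => qp; apply: nq.
      by exists q.
    move=> /subset_leq_card; rewrite cards1 => S1.
    have [h ph] := cov p; have : 0 < #|B|.
      by rewrite card_gt0; apply/finset.set0Pn; exists h; exact: (inB p).
    by lia.
  have [h /andP[qh ph]] := sep _ _ qp.
  have := inB _ _ qS qh; rewrite -NpB inE => ph'.
  by rewrite ph' in ph.
- move=> h hB; rewrite -(splitC _ S (e^~ h)) /k -[ltnLHS]add0n ltn_add2r card_gt0.
  apply/finset.set0Pn; apply: contrapT => none; apply: nSh; exists h => p pS.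
  by apply/negPn/negP => ph; apply: none; exists p; rewrite inE pS.
- move=> p h pS hB ph; have [g [ge gI]] := proj _ _ ph.
  rewrite /k /r -(card_in_imset (f := g) (D := mem [set p0 in S | e p0 h])).
    apply/subset_leq_card/fintype.subsetP => _ /imsetP[q + ->].
    by rewrite !inE => /andP[_ /ge/andP[]].
  by move=> x y; rewrite !inE => /andP[_ xh] /andP[_ yh]; exact: gI.
Qed.

End Nonincident.

(** * Covers, lines and hyperplanes in geometric lattices *)

Section Poset.
Import Order.TTheory.
Local Open Scope card_scope.
Local Open Scope order_scope.
Context (d : Order.disp_t) (P : porderType d).
Implicit Types x y z : P.

Lemma coversP x y :
  covers x y <-> x < y /\ forall z, x <= z -> z <= y -> z = x \/ z = y.
Proof.
rewrite /covers; set I := [set z | _]%classic.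
split=> [I2|[xy xyP]].
  have /card_eqPle[leI2 leI] := I2.
  have [f [fI fi]] := card_le_injective 0 leI2.
  have [g [gI gi]] := card_le_injective x leI.
  have xy : x <= y by have /andP[] := gI 0 isT; exact: le_trans.
  have Ix : I x by rewrite /I /= lexx.
  have Iy : I y by rewrite /I /= lexx andbT.
  have neq : x != y.
    apply: contra_not_neq (_ : ~ (0 = 1 :> nat)) => // eqxy.
    have only n : `I_2%classic n -> g n = x.
      by move=> /gI /=; rewrite /I /= -eqxy -eq_le => /eqP.
    by apply: gi => //; rewrite !only.
  split=> [|z xz zy]; first by rewrite lt_neqAle neq.
  have Iz : I z by rewrite /I /= xz.
  apply: contrapT => /not_orP[zx zy'].
  have fx := fI _ Ix; have fy := fI _ Iy; have fz := fI _ Iz; move: fx fy fz => /=.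
  have xy' : f x <> f y by move=> fxy; move/eqP: neq; apply; exact: fi.
  have zx' : f z <> f x by move=> fzx; apply: zx; exact: fi.
  have zy'' : f z <> f y by move=> fzy; apply: zy'; exact: fi.
  move: (f x) (f y) (f z) xy' zx' zy'' => [|[|?]] [|[|?]] [|[|?]] //.
apply/card_eqPle; split.
  apply: (injective_card_le (f := fun z => (z == y) : nat)) => [z _|z t].
    by case: (z == y).
  move=> /andP[xz zy] /andP[xt ty].
  have [->|->] := xyP _ xz zy; have [->|->] := xyP _ xt ty => //;
  by rewrite (lt_eqF xy) eqxx.
apply: (injective_card_le (f := fun n => if n == 0 then x else y)) => [[|[|n]]|] //=.
- by rewrite /I /= lexx ltW.
- by rewrite /I /= lexx ltW.
by move=> [|[|m]] [|[|n]] //= _ _ eqxy; move: xy; rewrite eqxy ltxx.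
Qed.

Lemma covers_lt x y : covers x y -> x < y.
Proof. by move=> /coversP[]. Qed.

Lemma covers_between x y z : covers x y -> x < z -> z <= y -> z = y.
Proof.
move=> /coversP[_ xyP] xz zy; have [zx|//] := xyP z (ltW xz) zy.
by rewrite zx ltxx in xz.
Qed.

(** An element outside the well-founded part starts an infinite sequence
    descending for [R], whose range is an infinite chain.  Taken for both [<]
    and [>], this gives the two chain conditions. *)
Lemma no_infinite_chains_wf (R : P -> P -> Prop) :
    no_infinite_chains P -> (forall x y z, R x y -> R y z -> R x z) ->
    (forall x, ~ R x x) -> (forall x y, R x y -> x >=< y) ->
  well_founded R.
Proof.
move=> nc tr irr comp x0; apply: contrapT => nA0.
have /choice[next nextP] x : exists y, ~ Acc R x -> ~ Acc R y /\ R y x.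
  have [Ax|nAx] := pselect (Acc R x); first by exists x.
  apply: contrapT => none; apply: (nAx); constructor => y yx.
  by apply: contrapT => nAy; apply: none; exists y.
pose u n := iter n next x0.
have nA n : ~ Acc R (u n) by elim: n => // n /nextP[].
have step n : R (u n.+1) (u n) by have [] := nextP _ (nA n).
have dec m n : (m < n)%N -> R (u n) (u m).
  elim: n => // n IHn; rewrite ltnS leq_eqVlt => /orP[/eqP->//|/IHn]; exact: tr.
have cmp m n : u m <= u n \/ u n <= u m.
  have [/dec/comp|/dec/comp|->] := ltngtP m n; last by left.
    by case/orP; [right|left].
  by case/orP; [left|right].
have fin : finite_set (range u).
  by apply: nc => _ _ [m _ <-] [n _ <-]; exact: cmp.
suff /infiniteP : ([set: nat] #<= range u)%classic by apply.
apply: (injective_card_le (f := u)) => [n _|m n _ _ umn]; first by exists n.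
have [/dec|/dec|//] := ltngtP m n; rewrite umn; by move=> /irr.
Qed.

Lemma no_infinite_chains_gt_wf :
  no_infinite_chains P -> well_founded (fun x y : P => y < x).
Proof.
move=> nc; apply: no_infinite_chains_wf => // [x y z yx zy|x|x y].
- exact: lt_trans zy yx.
- by rewrite ltxx.
- by move=> /ltW yx; rewrite /Order.comparable yx orbT.
Qed.

Lemma no_infinite_chains_lt_wf :
  no_infinite_chains P -> well_founded (fun x y : P => x < y).
Proof.
move=> nc; apply: no_infinite_chains_wf => // [x y z|x|x y].
- exact: lt_trans.
- by rewrite ltxx.
- by move=> /ltW yx; rewrite /Order.comparable yx.
Qed.

End Poset.

Section Geometric.
Import Order.TTheory.
Local Open Scope order_scope.
Context (d : Order.disp_t) (L : tbLatticeType d).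
Hypothesis geomL : geometric L.
Implicit Types u x y z p q a b h k : L.

Let smL : semimodular L. Proof. by case: geomL. Qed.
Let ncL : no_infinite_chains L. Proof. by case: geomL. Qed.
Let atL : atomistic L. Proof. by case: geomL. Qed.

Lemma exists_cover x y : x < y -> exists2 z, covers x z & z <= y.
Proof.
move=> xy; have [|z [xz zy] zmin] := well_founded_min
    (P := [set z | x < z /\ z <= y]%classic) (no_infinite_chains_lt_wf ncL).
  by exists y.
exists z => //; apply/coversP; split=> // t xt tz.
have [->|tz'] := eqVneq t z; first by right.
have [->|tx] := eqVneq t x; first by left.
case: (zmin t); first by rewrite lt_neqAle tz'.
by rewrite /= lt_neqAle eq_sym tx (le_trans tz).
Qed.

Lemma covers_neq_nle u p q : covers u p -> covers u q -> p != q -> ~~ (q <= p).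
Proof.
move=> up uq; apply: contra_neqN => qp.
by rewrite (covers_between up (covers_lt uq) qp).
Qed.

Lemma covers_join2 u p q : covers u p -> covers u q -> p != q -> covers p (p `|` q).
Proof.
move=> up uq pq; have [e [pe qe]] := smL up uq (elimN eqP pq).
suff -> : p `|` q = e by [].
apply: (covers_between pe); last first.
  by rewrite leUx (ltW (covers_lt pe)) (ltW (covers_lt qe)).
by rewrite lt_neqAle leUl andbT eq_sym eq_joinl (covers_neq_nle up).
Qed.

(** The lattice form of semimodularity, obtained by moving up from [u] to [x]
    through covers and applying the two-cover form at every step. *)
Lemma covers_join u p x : covers u p -> u <= x -> ~~ (p <= x) -> covers x (x `|` p).
Proof.
elim: (no_infinite_chains_gt_wf ncL u) p => {}u _ IH p up ux px.
have [->//|xu] := eqVneq x u.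
  suff -> : u `|` p = p by [].
  by apply/join_idPr; rewrite ltW// covers_lt.
have [u' uu' u'x] : exists2 u', covers u u' & u' <= x.
  by apply: exists_cover; rewrite lt_neqAle eq_sym xu.
have u'p : u' != p by apply: contraNneq px => <-.
have := IH u' (covers_lt uu') _ (covers_join2 uu' up u'p) u'x.
rewrite leUx u'x /= => /(_ px).
by rewrite joinA (join_idPl u'x).
Qed.

(** The interval from [u] to the top is again atomistic: an atom of the lattice
    below [x] but not below [h] has a join with [u] covering [u]. *)
Lemma cover_separation u x h : u <= x -> u <= h -> ~~ (x <= h) ->
  exists a, [/\ covers u a, a <= x & ~~ (a <= h)].
Proof.
move=> ux uh xh; have [S SA [Sx lubx]] := atL x.
have [s Ss sh] : exists2 s, S s & ~~ (s <= h).
  apply: contrapT => none; move/negP: xh; apply; apply: lubx => s Ss.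
  by apply/negPn/negP => sh; apply: none; exists s.
have sx : s <= x by exact: Sx.
exists (u `|` s); split; first 1 last.
- by rewrite leUx ux.
- by rewrite leUx uh.
apply: (@covers_join \bot) (SA _ Ss) _ _; first exact: le0x.
by apply: contraNN sh => /le_trans; exact.
Qed.

(** Every element is a meet of hyperplanes.  An element [h] above [x], maximal
    among those not above [y], is covered by [h `|` y], which is below everything
    strictly above [h]; were it not the top, some cover of [h] would not lie
    below it, and yet be above [y]. *)
Lemma hyperplane_separation x y : ~~ (y <= x) ->
  exists h, [/\ covers h \top, x <= h & ~~ (y <= h)].
Proof.
move=> yx; have [|h [xh yh] hmax] := well_founded_min
    (P := [set z | x <= z /\ ~~ (y <= z)]%classic) (no_infinite_chains_gt_wf ncL).
  by exists x.
exists h; split=> //; have above z : h < z -> y <= z.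
  move=> hz; apply/negPn/negP => yz; apply: (hmax z hz); split=> //.
  exact: le_trans xh (ltW hz).
have hy : h < h `|` y by rewrite lt_neqAle leUl andbT eq_sym eq_joinl.
have hyT : h `|` y = \top.
  apply/eqP; rewrite -le1x; apply/negPn/negP => nT.
  have [a [ha _ ahy]] := cover_separation (lex1 h) (leUl h y) nT.
  have yha : h `|` y <= a by rewrite leUx ltW ?covers_lt//= above// covers_lt.
  by rewrite (covers_between ha hy yha) lexx in ahy.
apply/coversP; split=> [|z hz _]; first by rewrite -hyT.
have [->|zh] := eqVneq z h; [by left|right].
have hz' : h < z by rewrite lt_neqAle eq_sym zh.
by apply/eqP; rewrite -le1x -hyT leUx hz above.
Qed.

Lemma covers_line u p q b : covers u p -> covers u q -> covers u b ->
  p != q -> b <= p `|` q -> covers b (p `|` q).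
Proof.
move=> up uq ub pq bpq; have [->|bp] := eqVneq b p; first exact: covers_join2 up uq pq.
suff -> : p `|` q = b `|` p by exact: covers_join2 ub up bp.
apply/esym; apply: covers_between (covers_join2 up uq pq) _ _; last first.
  by rewrite leUx bpq leUl.
by rewrite lt_neqAle leUr andbT eq_sym eq_joinr (covers_neq_nle up)// eq_sym.
Qed.

Lemma line_through u p q a b :
    covers u p -> covers u q -> covers u a -> covers u b -> p != q -> a != b ->
  a <= p `|` q -> b <= p `|` q -> a `|` b = p `|` q.
Proof.
move=> up uq ua ub pq ab apq bpq.
apply: covers_between (covers_line up uq ua pq apq) _ _; last by rewrite leUx apq.
exact: covers_lt (covers_join2 ua ub ab).
Qed.

End Geometric.

(** * Matchings of upper intervals *)

Section Matching.
Import Order.TTheory.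
Local Open Scope card_scope.
Local Open Scope order_scope.
Context (d : Order.disp_t) (L : tbLatticeType d).
Hypothesis geomL : geometric L.
Implicit Types u x y z p q a b h k : L.

Definition atoms_over u : set L := [set a | covers u a]%classic.
Definition hyperplanes_over u : set L := [set h | covers h \top /\ u <= h]%classic.

Definition off_line u p q : set L :=
  [set a | covers u a /\ ~~ (a <= (p `|` q)%O)]%classic.

(** A matching of the interval from [u] to the top.  The functions are total on
    the lattice, with meaningless values away from the atoms over [u]. *)
Definition matchable u := exists m : L -> L,
  (forall p, atoms_over u p -> hyperplanes_over p (m p)) /\
  (forall p q, atoms_over u p -> atoms_over u q -> m p = m q -> p = q).

(** The points [a] of [h] span distinct lines with a point [p] off [h], and a
    matching of the interval above [p] sends these lines to distinct
    hyperplanes, each containing both [p] and [a]. *)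
Lemma nonincident_projection u p h : matchable p ->
    covers u p -> u <= h -> ~~ (p <= h) ->
  exists g : L -> L,
    (forall a, covers u a -> a <= h ->
       hyperplanes_over a (g a) /\ hyperplanes_over p (g a)) /\
    (forall a b, covers u a -> covers u b -> a <= h -> b <= h -> g a = g b -> a = b).
Proof.
move=> [m [mP mI]] up uh ph; exists (fun a => m (p `|` a)).
have neq a : a <= h -> p != a by move=> ah; apply: contraNneq ph => ->.
have pa a : covers u a -> a <= h -> covers p (p `|` a).
  by move=> ua ah; apply: (covers_join2 geomL up ua); exact: neq.
split=> [a ua ah|a b ua ub ah bh /mI eqab].
  have [hyp] := mP _ (pa a ua ah); rewrite leUx => /andP[pm am]; by [].
apply/eqP; apply: contraNT ph => ab.
have {}eqab : p `|` a = p `|` b by apply: eqab; exact: pa.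
apply: (@le_trans _ _ (a `|` b)); last by rewrite leUx ah.
rewrite (line_through geomL up ua ua ub (neq a ah) ab) ?leUl ?leUr// eqab leUr.
by [].
Qed.

(** A hyperplane is determined by the atoms below it, so there are finitely many
    of them and the finite incidence lemma applies. *)
Lemma finite_atoms_matchable u :
    ~ covers u \top ->
    finite_set (atoms_over u) -> (forall p, covers u p -> matchable p) ->
  matchable u.
Proof.
move=> nuT finA IH.
pose T := fset_set (atoms_over u).
have TP (t : T) : covers u (val t).
  by have := valP t; rewrite in_fset_set// inE.
have toT a : covers u a -> exists t : T, val t = a.
  move=> ua; have aT : a \in fset_set (atoms_over u) by rewrite in_fset_set// inE.
  by exists (FSetSub aT).
have sepA x h : u <= x -> u <= h -> ~~ (x <= h) ->
    exists t : T, (val t <= x) && ~~ (val t <= h).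
  move=> ux uh /(cover_separation geomL ux uh)[a [/toT[t <-] ax ah]].
  by exists t; rewrite ax.
have finH : finite_set (hyperplanes_over u).
  apply: (card_le_finite (B := [set: {set T}]%classic)); last exact: finite_finset.
  pose tr h := [set t : T | val t <= h]%SET.
  apply: (injective_card_le (f := tr)) => // h k [_ uh] [_ uk] hk.
  have le x y : u <= x -> u <= y -> tr x = tr y -> x <= y.
    move=> ux uy /setP xy; apply/negPn/negP => /(sepA _ _ ux uy)[t].
    by have := xy t; rewrite !inE => ->; rewrite andbN.
  by apply: le_anti; rewrite (le h k)// (le k h).
pose U := fset_set (hyperplanes_over u).
have UP (s : U) : hyperplanes_over u (val s).
  by have := valP s; rewrite in_fset_set// inE.
have toU h : covers h \top -> u <= h -> exists s : U, val s = h.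
  move=> hT uh; have hU : h \in fset_set (hyperplanes_over u).
    by rewrite in_fset_set// inE.
  by exists (FSetSub hU).
have sepH (t : T) y : ~~ (y <= val t) ->
    exists s : U, (val t <= val s) && ~~ (y <= val s).
  move=> /(hyperplane_separation geomL)[h [hT th yh]].
  have [s sh] := toU h hT (le_trans (ltW (covers_lt (TP t))) th).
  by exists s; rewrite sh th.
have [|||t s ts|f fI fP] := @finite_nonincidence_matching T U
    (fun t s => val t <= val s).
- move=> t; have [|s /andP[ts _]] := sepH t \top; last by exists s.
  by rewrite le1x; apply/eqP => tT; apply: nuT; rewrite -tT.
- move=> t t' tt'; apply: sepH; apply: (covers_neq_nle (TP t) (TP t')).
  by rewrite (inj_eq val_inj).
- move=> s; have [hT uh] := UP s.
  have [||t /andP[_ ts]] := sepA \top (val s) _ uh; [exact: lex1| |by exists t].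
  by rewrite le1x; apply/eqP => sT; move: (covers_lt hT); rewrite sT ltxx.
- have [hT uh] := UP s.
  have [g [gP gI]] := nonincident_projection (IH _ (TP t)) (TP t) uh ts.
  have /choice[g' g'P] (q : T) : exists r : U, val q <= val s -> val r = g (val q).
    have [qs|_] := boolP (val q <= val s); last by exists s.
    have [[gT qg] _] := gP _ (TP q) qs.
    have [r rg] := toU _ gT (le_trans (ltW (covers_lt (TP q))) qg).
    by exists r.
  exists g'; split=> [q qs|q r].
    by rewrite g'P//; have [[_ ->] [_ ->]] := gP _ (TP q) qs.
  rewrite !inE => qs rs /(congr1 val); rewrite !g'P// => /gI gqr.
  by apply: val_inj; apply: gqr.
have /choice[m mP] a : exists h, covers u a -> exists2 t : T, val t = a & h = val (f t).
  have [/toT[t ta]|na] := pselect (covers u a); last by exists a.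
  by exists (val (f t)) => _; exists t.
exists m; split=> [a /mP[t <- ->]|a b /mP[t <- ->] /mP[s <- ->] /val_inj/fI-> //].
by split; [case: (UP (f t))|exact: fP].
Qed.

(** A point off the line through [p] and [q] is the intersection of the lines
    joining it to [p] and to [q]; matchings above [p] and [q] turn these lines
    into hyperplanes. *)
Lemma off_line_card_le u p q :
    covers u p -> covers u q -> p != q -> matchable p -> matchable q ->
  off_line u p q #<=
    (hyperplanes_over p `*` hyperplanes_over q)%classic.
Proof.
move=> up uq pq [m [mP mI]] [n [nP nI]].
have neq a : ~~ (a <= p `|` q) -> (p != a) && (q != a).
  by move=> al; apply/andP; split; apply: contraNneq al => <-; rewrite ?leUl ?leUr.
have pa a : covers u a -> ~~ (a <= p `|` q) -> covers p (p `|` a).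
  by move=> ua /neq/andP[pna _]; exact: (covers_join2 geomL up ua).
have qa a : covers u a -> ~~ (a <= p `|` q) -> covers q (q `|` a).
  by move=> ua /neq/andP[_ qna]; exact: (covers_join2 geomL uq ua).
have over r s h : hyperplanes_over (r `|` s) h -> hyperplanes_over r h.
  by move=> [hT]; rewrite leUx => /andP[].
apply: (injective_card_le (f := fun a => (m (p `|` a), n (q `|` a)))).
  move=> a [ua al]; split=> /=; apply: over.
    by apply: mP; exact: pa.
  by apply: nP; exact: qa.
move=> a b [ua al] [ub bl] [/mI eqp /nI eqq].
have {}eqp : p `|` a = p `|` b by apply: eqp; exact: pa.
have {}eqq : q `|` a = q `|` b by apply: eqq; exact: qa.
have /andP[pna qna] := neq _ al.
apply/eqP; apply: contraNT al => ab.
have pab : p <= a `|` b.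
  by rewrite (line_through geomL up ua ua ub pna ab) ?leUl ?leUr// eqp leUr.
have qab : q <= a `|` b.
  by rewrite (line_through geomL uq ua ua ub qna ab) ?leUl ?leUr// eqq leUr.
by rewrite (line_through geomL ua ub up uq ab pq pab qab) leUl.
Qed.

(** The points off the line [l] are fewer than all points.  By cardinality some
    point [a0] of [l] lies on no line joining two points off [l].  The lines
    through [a0] and the points off [l] are then distinct, and different from
    [l], so a matching [m] above [a0] serves the points off [l], and [a0] itself
    through [l].  These hyperplanes contain [a0]; any other
    point [b] of [l] takes a hyperplane avoiding [a0], which meets [l] only in
    [b]. *)
Lemma dominant_line_matchable u p q :
    (forall r, covers u r -> matchable r) -> infinite_set (atoms_over u) ->
    covers u p -> covers u q -> p != q ->
    ~ (atoms_over u #<= off_line u p q) ->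
  matchable u.
Proof.
move=> IH infA up uq pq; set l := p `|` q; set Q := off_line u p q => small.
have [a0 [ua0 a0l a0Q]] : exists a0, [/\ covers u a0, a0 <= l &
    forall b c, Q b -> Q c -> b != c -> ~~ (a0 <= b `|` c)].
  apply: contrapT => none.
  have /choice[g gP] a : exists bc : L * L, covers u a ->
      [/\ Q bc.1, Q bc.2 & if a <= l then (bc.1 != bc.2) && (a <= bc.1 `|` bc.2)
                           else bc == (a, a)].
    have [al|al] := boolP (a <= l); last by exists (a, a) => ua; split=> //; split.
    apply: contrapT => nbc; have [ua|nua] := pselect (covers u a); last first.
      by apply: nbc; exists (a, a).
    apply: none; exists a; split=> // b c Qb Qc bc; apply/negP => abc.
    by apply: nbc; exists (b, c) => _; split=> //=; rewrite bc.
  (* [g] sends a point of [l] to two points off [l] whose line contains it, and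
     a point off [l] to the diagonal, so that [Q] has too large a square. *)
  have : atoms_over u #<= (Q `*` Q)%classic.
    apply: (injective_card_le (f := g)) => [a /gP[]//|a b ua ub eqg].
    have [_ Qa2 ga] := gP _ ua; have [Qb1 Qb2 gb] := gP _ ub.
    move: ga gb Qa2; rewrite eqg; case: ifP => al; case: ifP => bl.
    - move=> /andP[g12 ag] /andP[_ bg] _; apply/eqP/negPn/negP => ab.
      have [uc cl] := Qb1; have [ud dl] := Qb2; move/negP: cl; apply.
      rewrite /l -(line_through geomL up uq ua ub pq ab al bl).
      by rewrite (line_through geomL uc ud ua ub g12 ab ag bg) leUl.
    - by move=> /andP[/eqP g12 _] /eqP gb; case: g12; rewrite gb.
    - by move=> /eqP -> /andP[/eqP].
    - by move=> /eqP -> /eqP[].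
  by move=> /(infinite_card_le_setX infA)[].
have [m [mP mI]] := IH _ ua0.
have /choice[n nP] b : exists h, covers u b -> b != a0 ->
    [/\ covers h \top, b <= h & ~~ (a0 <= h)].
  have [[ub ba0]|nb] := pselect (covers u b /\ b != a0).
    by have [h hP] := hyperplane_separation geomL (covers_neq_nle ub ua0 ba0); exists h.
  by exists b => ub ba0; case: nb.
(* The line through [a0] assigned to [a]. *)
pose k a := if a == a0 then l else a0 `|` a.
pose far a := (a == a0) || ~~ (a <= l).
have ka a : covers u a -> far a -> covers a0 (k a) /\ a <= k a.
  rewrite /k /far => ua; have [->|aa0 /= al] := eqVneq a a0.
    by split=> //; exact: (covers_line geomL up uq ua0 pq).
  by split; [apply: (covers_join2 geomL ua0 ua); rewrite eq_sym|exact: leUr].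
have kI a b : covers u a -> covers u b -> far a -> far b -> k a = k b -> a = b.
  rewrite /k /far => ua ub.
  have [->|aa0] := eqVneq a a0; have [->|ba0] := eqVneq b a0 => //=.
  - by move=> _ bl lb; rewrite lb leUr in bl.
  - by move=> al _ la; rewrite -la leUr in al.
  move=> al bl kab; apply/eqP/negPn/negP => ab.
  have := a0Q a b (conj ua al) (conj ub bl) ab.
  rewrite eq_sym in aa0.
  by rewrite (line_through geomL ua0 ua ua ub aa0 ab) ?leUl ?leUr// kab leUr.
exists (fun a => if far a then m (k a) else n a); split=> [a ua|a b ua ub].
  case: ifP => [fa|/negbT]; last first.
    by rewrite negb_or => /andP[aa0 _]; have [] := nP _ ua aa0.
  have [kc ak] := ka _ ua fa; have [mT km] := mP _ kc.
  by split=> //; exact: le_trans km.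
have a0m c : covers u c -> far c -> a0 <= m (k c).
  move=> uc /(ka _ uc)[kc _]; have [_] := mP _ kc; apply: le_trans.
  exact: ltW (covers_lt kc).
have a0n c : covers u c -> ~~ far c -> ~~ (a0 <= n c).
  by move=> uc; rewrite negb_or => /andP[ca0 _]; have [] := nP _ uc ca0.
case: ifP => [fa|/negbT fa]; case: ifP => [fb|/negbT fb].
- move=> /mI mab; apply: kI => //.
  by apply: mab; [case: (ka _ ua fa)|case: (ka _ ub fb)].
- by move=> eqab; have := a0n _ ub fb; rewrite -eqab a0m.
- by move=> eqab; have := a0n _ ua fa; rewrite eqab a0m.
move=> eqab; apply/eqP/negPn/negP => ab.
have := fa; have := fb; rewrite !negb_or !negbK => /andP[ba0 bl] /andP[aa0 al].
have [nT an nan] := nP _ ua aa0; have [_ bn _] := nP _ ub ba0.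
case/negP: nan; apply: le_trans a0l _.
by rewrite /l -(line_through geomL up uq ua ub pq ab al bl) leUx an eqab bn.
Qed.

(** If no line is dominant, two points cannot both lie on fewer hyperplanes than
    there are points, as the points off the line joining them would then be too
    few.  So there is at most one such point [p0]; it is served first, by [h0],
    and all the others by greedy choice. *)
Lemma spread_matchable u :
    ~ covers u \top -> (forall r, covers u r -> matchable r) ->
    infinite_set (atoms_over u) ->
    (forall p q, covers u p -> covers u q -> p != q ->
       atoms_over u #<= off_line u p q) ->
  matchable u.
Proof.
move=> nuT IH infA large.
have two p q : covers u p -> covers u q -> p != q ->
    atoms_over u #<= hyperplanes_over p \/ atoms_over u #<= hyperplanes_over q.
  move=> up uq pq; apply: (infinite_card_le_setX infA).
  apply: card_le_trans (large _ _ up uq pq) _.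
  by apply: off_line_card_le => //; exact: IH.
have [p0 [up0 p0P]] : exists p0, covers u p0 /\ forall p, covers u p -> p != p0 ->
    atoms_over u #<= hyperplanes_over p.
  have [[p0 [up0 p0small]]|none] := pselect (exists p0, covers u p0 /\
      ~ (atoms_over u #<= hyperplanes_over p0)).
    by exists p0; split=> // p up pp0; have [//|/p0small] := two _ _ up up0 pp0.
  have [p0 up0] := infinite_setN0 infA; exists p0; split=> // p up _.
  by apply: contrapT => np; apply: none; exists p.
have [h0 [h0T p0h0 _]] : exists h, [/\ covers h \top, p0 <= h & ~~ (\top <= h)].
  apply: (hyperplane_separation geomL); rewrite le1x; apply/eqP => p0T.
  by apply: nuT; rewrite -p0T.
(* Removing [p0] and [h0] does not spoil the cardinalities, the set of points
   being infinite. *)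
pose A := (atoms_over u `\ p0)%classic.
have AinfF p : A p -> A #<= (hyperplanes_over p `\ h0)%classic.
  move=> [up /eqP pp0]; have le := p0P _ up pp0.
  apply: card_le_trans (card_le_setD _ _) _; apply: (card_le_trans le).
  by apply: infinite_setD1_card_ge => fin; apply: infA; apply: card_le_finite fin.
have [f [fP fI]] := injective_choice h0 AinfF.
have inA a : covers u a -> a != p0 -> A a by move=> ua /eqP.
exists (fun a => if a == p0 then h0 else f a); split=> [a ua|a b ua ub].
  by case: eqVneq => [->|ap0]; [|case: (fP _ (inA _ ua ap0))].
case: eqVneq => [->|ap0]; case: eqVneq => [->|bp0] //.
- by have [_ nb] := fP _ (inA _ ub bp0) => /esym.
- by have [_ na] := fP _ (inA _ ua ap0).
- by apply: fI; exact: inA.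
Qed.

(** When some cover of [u] is a hyperplane, all are, by semimodularity, and the
    identity is a matching.  Otherwise the intervals above the covers of [u] are
    matchable by induction, as the preceding lemmas require. *)
Lemma all_matchable u : u != \top -> ~ covers u \top -> matchable u.
Proof.
have [_ nc _] := geomL; elim: (no_infinite_chains_gt_wf nc u) => {}u _ IH uT nuT.
have [[p [up pT]]|high] := pselect (exists p, covers u p /\ covers p \top).
  exists id; split=> // q uq; split=> //.
  have [->//|qp] := eqVneq q p.
  have pq : covers p (p `|` q) by apply: (covers_join2 geomL up uq); rewrite eq_sym.
  have pqT : p `|` q = \top by apply: (covers_between pT (covers_lt pq)); exact: lex1.
  by rewrite -pqT joinC; exact: (covers_join2 geomL uq up).
have IHu p : covers u p -> matchable p.
  move=> up; apply: IH; first exact: covers_lt.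
    by apply/eqP => pT; apply: nuT; rewrite -pT.
  by move=> pT; apply: high; exists p.
have [fin|inf] := pselect (finite_set (atoms_over u)).
  exact: finite_atoms_matchable.
have [[p [q [up uq pq small]]]|large] := pselect (exists p q,
    [/\ covers u p, covers u q, p != q & ~ (atoms_over u #<= off_line u p q)]).
  exact: (dominant_line_matchable IHu inf up uq pq).
apply: spread_matchable => // p q up uq pq; apply: contrapT => small.
by apply: large; exists p, q.
Qed.

End Matching.

Section Bottom.
Import Order.TTheory.
Local Open Scope card_scope.
Local Open Scope order_scope.

Lemma matchable_bottom_matching (d : Order.disp_t) (L : tbLatticeType d) :
  matchable (\bot : L) -> exists f : atoms L -> hyperplanes L, is_matching f.
Proof.
move=> [m [mP mI]]; have mH (p : atoms L) : val p \in atoms L by exact: valP.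
have mT (p : atoms L) : m (val p) \in hyperplanes L.
  by apply/mem_set; have [] := mP _ (set_mem (mH p)).
exists (fun p => SigSub (mT p)); split=> [p q /(congr1 val)/= mpq|p /=].
  by apply: val_inj; apply: mI mpq; exact: set_mem (mH _).
by have [] := mP _ (set_mem (mH p)).
Qed.

(** In rank at most one the whole lattice is a chain with one or two elements,
    so the cardinality of maximal chains excludes that case. *)
Lemma rank_gt1_bottom (d : Order.disp_t) (L : tbLatticeType d) (r : nat) :
    has_rank L r -> (1 < r)%N ->
  \bot != \top :> L /\ ~ covers (\bot : L) \top.
Proof.
move=> rankL r_gt1.
have cardT : chain [set: L]%classic -> [set: L]%classic #= `I_r.+1%classic.
  by move=> chT; apply: rankL; split=> // D [_ nD]; case: nD.
split.
  apply/eqP => eqT; have all0 (x : L) : x = \bot.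
    by apply/eqP; rewrite -lex0 eqT lex1.
  have T1 : [set: L]%classic = [set \bot]%classic.
    by apply/seteqP; split=> x //= _; exact: all0.
  have /cardT : chain [set: L]%classic.
    by move=> x y _ _; left; rewrite (all0 x) le0x.
  rewrite T1 (card_eql card_set1) => /card_eq_II[r0].
  by rewrite -r0 in r_gt1.
move=> cov; have allT : [set: L]%classic = [set z : L | \bot <= z <= \top]%classic.
  by apply/seteqP; split=> x //= _; rewrite le0x lex1.
have /cardT : chain [set: L]%classic.
  have [_ covP] := (coversP _ _).1 cov.
  move=> x y _ _; have [->|->] := covP x (le0x x) (lex1 x); first by left; exact: le0x.
  by right; exact: lex1.
rewrite allT (card_eql cov) => /card_eq_II[r1].
by rewrite -r1 in r_gt1.
Qed.

End Bottom.

Theorem theorem11 (d : Order.disp_t) (L : tbLatticeType d) (r : nat)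
    (geomL : geometric L) (rankL : has_rank L r) (r_gt1 : 1 < r) :
  exists f : atoms L -> hyperplanes L, is_matching f.
Proof.
apply: matchable_bottom_matching.
have [botT nbotT] := rank_gt1_bottom rankL r_gt1.
exact: all_matchable.
Qed.
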